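(* Let $G$ be a simple graph with $n$ vertices and $m$ edges, and let $\vec r=(n-1,n-1,\dots,n-1)\in\mathbb{Z}^r$ be a color vector with $r$ entries for some integer $r\ge 2$. Then the number of $i$-cells of $S_{\vec r}(G)$ is $$\#(i\text{-cells})=\begin{cases}\displaystyle\binom{r}{i}\Bigl(m^i n^{r-i}-\sum_{v\in V(G)}\deg(v)^i\Bigr)&\text{if } 0\le i<r,\\[3mm] \displaystyle m^r+m-\sum_{v\in V(G)}\deg(v)^r&\text{if } i=r,\\[3mm] 0&\text{if } i>r,\end{cases}$$ where $0^0=1$.
   Context: A simple graph has no loops or multiple edges. $V(G)$ is the set of vertices and $E(G)$ the set of closed edges (edges viewed as sets of points including their endpoints) of $G$; $\deg(v)$ is the degree of the vertex $v$. A color vector is a vector $\vec r=(\ell_1,\dots,\ell_r)$ of positive integers (so here $n-1\ge 1$); $1,\dots,r$ are called colors. A cell of the grouped Stirling complex $S_{\vec r}(G)$ is an $r$-tuple $c=(c_1,\dots,c_r)$ such that: (a) $c_i\subset V(G)\cup E(G)$ and $|c_i|=\ell_i$ for $i=1,\dots,r$; (b) for each $v\in V(G)$ there is some $i$ with $v\in c_i$; (c) for each $i$, $\sigma\cap\sigma'=\emptyset$ for all distinct vertices and/or closed edges $\sigma,\sigma'\in c_i$. The dimension of $c$ is the number of (not necessarily distinct) edges appearing in $c$, i.e. $\sum_{i=1}^r|c_i\cap E(G)|$; a cell of dimension $k$ is called a $k$-cell. *)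

(* Defs.v *)
From mathcomp Require Import all_boot all_order all_algebra.

Set Implicit Arguments.
Unset Strict Implicit.
Unset Printing Implicit Defensive.

Record sgraph := SGraph {
  vertex :> finType;
  adj : rel vertex;
  adj_sym : symmetric adj;
  adj_irrefl : irreflexive adj
}.

Section GroupedStirlingComplex.

Variable G : sgraph.

(* V(G) and E(G) are both families of simplices of G, a simplex being given by
   its finite set of vertices: the vertex v is [set v] and the closed edge uv
   is [set u; v].  As G has no multiple edges, two distinct simplices of G meet
   as sets of points iff these vertex sets meet. *)
Definition vertices : {set {set G}} := [set [set v] | v : G].
Definition edges : {set {set G}} :=
  [set [set p.1; p.2] | p : G * G & adj p.1 p.2].

Definition deg (v : G) : nat := #|[set u | adj v u]|.

Definition color_vector (r : nat) (l : r.-tuple nat) : Prop :=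
  forall i, 0 < tnth l i.

Variables (r : nat) (l : r.-tuple nat).

Definition is_cell (c : r.-tuple {set {set G}}) : bool :=
  [&& [forall i, (tnth c i \subset vertices :|: edges)
                 && (#|tnth c i| == tnth l i)],
      [forall v : G, exists i, [set v] \in tnth c i]
    & [forall i, forall s in tnth c i, forall t in tnth c i,
         (s != t) ==> (s :&: t == set0)]].

Definition dim (c : r.-tuple {set {set G}}) : nat :=
  \sum_(i < r) #|tnth c i :&: edges|.

Definition kcells (k : nat) : {set r.-tuple {set {set G}}} :=
  [set c | is_cell c & dim c == k].

End GroupedStirlingComplex.

(* Main.v *)
(** A color has n - 1 pairwise disjoint simplices among n vertices, so it contains at most one
    edge; hence it is determined by the set s of vertices v with [set v] not in it, and s ranges
    exactly over the simplices of G. Covering all vertices means that the simplices s_1, ..., s_r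
    have empty intersection, and the dimension is the number of edges among them. For a fixed set
    A of colors carrying an edge, the tuples are counted by a product, and the sizes of the
    intersections add up to the sum of the deg(v)^|A|. An intersection has at most one element,
    unless all the s_i are the same edge, which accounts for the extra m when i = r. *)

Require Import Defs.
From mathcomp Require Import all_boot all_order all_algebra.
From mathcomp Require Import zify.

Import GRing.Theory.
Local Open Scope ring_scope.

(** * Simplices of the graph and the colors they determine *)

Section Simplices.

Local Open Scope nat_scope.

Variable G : sgraph.
Implicit Types (s t : {set G}) (c : {set {set G}}) (v : G).

Lemma card_edge s : s \in edges G -> #|s| = 2.
Proof.
case/imsetP=> -[u v]; rewrite inE /= => adj_uv ->; rewrite cards2.
by case: eqVneq adj_uv => // ->; rewrite adj_irrefl.
Qed.

Lemma set1_notin_edges v : ([set v] \in edges G) = false.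
Proof. by apply/negP => /card_edge; rewrite cards1. Qed.

Lemma set1_in_vertices v : [set v] \in vertices G.
Proof. exact: imset_f. Qed.

Lemma card_vertices : #|vertices G| = #|G|.
Proof. by rewrite card_imset //; apply: set1_inj. Qed.

Lemma card_edges_at v : #|[set s in edges G | v \in s]| = deg v.
Proof.
rewrite /deg -(card_in_imset (f := fun u => [set v; u])) => [|u w]; last first.
  rewrite !inE => vu vw /setP/(_ u); rewrite !inE eqxx orbT.
  by case: eqVneq vu => [->|_ _ /esym/eqP //]; rewrite adj_irrefl.
apply: eq_card => s; rewrite inE; apply/andP/imsetP.
- case=> /imsetP[[u w]]; rewrite inE /= => adj_uw ->.
  rewrite !inE => /orP[]/eqP eq_v; subst v; first by exists w; rewrite ?inE.
  by exists u; rewrite ?inE 1?adj_sym // setUC.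
- case=> u; rewrite inE => vu ->; rewrite !inE eqxx; split=> //.
  by apply/imsetP; exists (v, u); rewrite ?inE.
Qed.

Lemma card_vertices_at v : #|[set s in vertices G | v \in s]| = 1.
Proof.
rewrite -(cards1 [set v]); apply: eq_card => s; rewrite !inE.
apply/andP/eqP => [[/imsetP[w _ ->]]|->]; last by rewrite set1_in_vertices set11.
by rewrite inE => /eqP->.
Qed.

Lemma card_simplex s : s \in vertices G :|: edges G ->
  #|s| = 1 + (s \in edges G).
Proof.
rewrite inE => /orP[/imsetP[v _ ->]|se]; first by rewrite cards1 set1_notin_edges.
by rewrite se card_edge.
Qed.

(** Meant for a simplex [s]: a vertex gives all the other vertices, an edge gives itself together
    with the vertices off it. Intersecting with [edges G] adds [s] only when it is an edge, so one
    formula serves both cases. *)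
Definition color_of s : {set {set G}} :=
  [set [set v] | v in ~: s] :|: ([set s] :&: edges G).

Lemma set1_color_of s v : ([set v] \in color_of s) = (v \notin s).
Proof.
rewrite !inE set1_notin_edges andbF orbF mem_imset ?inE //.
exact: set1_inj.
Qed.

(** The set [s] is recovered as the vertices whose singletons are absent from [color_of s]. *)
Lemma color_of_inj : injective color_of.
Proof.
move=> s t eq_st; apply/setP=> v; apply: negb_inj.
by rewrite -!set1_color_of eq_st.
Qed.

Lemma set1s_edges (A : {set G}) : [set [set v] | v in A] :&: edges G = set0.
Proof.
apply/setP=> t; rewrite !inE; case: imsetP => [[v _ ->]|//].
exact: set1_notin_edges.
Qed.

Lemma color_of_edges s : color_of s :&: edges G = [set s] :&: edges G.
Proof. by rewrite setIUl set1s_edges set0U -setIA setIid. Qed.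

Lemma card_set1_edges s : #|[set s] :&: edges G| = (s \in edges G).
Proof.
case: (boolP (s \in edges G)) => se.
  by rewrite (setIidPl _) ?sub1set ?cards1.
by rewrite disjoint_setI0 ?cards0 // disjoints1.
Qed.

Definition is_color (k : nat) c : bool :=
  [&& c \subset vertices G :|: edges G, #|c| == k
    & [forall s in c, forall t in c, (s != t) ==> (s :&: t == set0)]].

Lemma color_of_is_color s :
  s \in vertices G :|: edges G -> is_color #|G|.-1 (color_of s).
Proof.
move=> s_simp; apply/and3P; split.
- by apply: setUSS; [apply: imsetS; apply/subsetP | apply: subsetIr].
(* With n vertices, the size is n - |s|, plus 1 if [s] is an edge; since |s| is 1, plus 1 if [s] is
   an edge, this is n - 1. *)
- rewrite cardsU setICA set1s_edges setI0 cards0 card_set1_edges.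
  rewrite card_imset; last exact: set1_inj.
  have := card_simplex _ s_simp; have := cardsC s.
  lia.
- apply/forall_inP => a ca; apply/forall_inP => b cb; apply/implyP.
  rewrite setI_eq0; rewrite in_setU in ca; rewrite in_setU in cb.
  case/orP: ca => [/imsetP[u us ->]|]; case/orP: cb => [/imsetP[w ws ->]|].
  + by rewrite disjoints1 inE; apply: contraNneq => ->.
  + by rewrite !inE in us * => /andP[/eqP-> _] _; rewrite disjoints1.
  + rewrite !inE in ws * => /andP[/eqP-> _] _.
    by rewrite disjoint_sym disjoints1.
  + by rewrite !inE => /andP[/eqP-> _] /andP[/eqP-> _]; rewrite eqxx.
Qed.

Lemma is_color_color_of c : 0 < #|G| -> is_color #|G|.-1 c ->
  exists2 s, s \in vertices G :|: edges G & c = color_of s.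
Proof.
move=> n_gt0 /and3P[/subsetP c_sub /eqP card_c /forall_inP disj_c].
have triv_c : trivIset c.
  apply/trivIsetP => a b ca cb neq_ab; rewrite -setI_eq0.
  by move/forall_inP: (disj_c a ca) => /(_ b cb)/implyP; apply.
(* Disjoint members have total size at most n, while n - 1 members have total size n - 1 plus the
   number of edges. *)
have card_cE : #|c :&: edges G| <= 1.
  have : #|cover c| <= #|G| by apply: max_card.
  rewrite -(eqP triv_c) (eq_bigr (fun s => 1 + (s \in edges G))); last first.
    by move=> s sc; apply/card_simplex/c_sub.
  rewrite big_split /= sum1_card -big_mkcondr /= sum1dep_card card_c.
  rewrite -[X in _ + X <= _](_ : #|c :&: edges G| = _); last first.
    by apply: eq_card => s; rewrite !inE.
  by rewrite -[X in _ <= X](prednK n_gt0) -addn1 leq_add2l.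
pose s := [set v | [set v] \notin c].
have cE : c = [set [set v] | v in ~: s] :|: (c :&: edges G).
  apply/setP=> t; rewrite !inE; apply/idP/orP => [tc|[/imsetP[v vs ->]|/andP[]//]].
    have := c_sub _ tc; rewrite inE => /orP[/imsetP[v _ eq_t]|->]; last by right; rewrite tc.
    by left; apply/imsetP; exists v; rewrite // !inE negbK -eq_t.
  by move: vs; rewrite !inE negbK.
(* Compare cardinalities in [cE]: n - 1 is n - |s| plus the number of edges in [c]. *)
have card_s : #|s| = 1 + #|c :&: edges G|.
  have := congr1 (fun d : {set {set G}} => #|d|) cE.
  rewrite cardsU card_c.
  rewrite setICA set1s_edges setI0 cards0 card_imset; last exact: set1_inj.
  have := cardsC s; lia.
case: (set_0Vmem (c :&: edges G)) => [cE0|[e eP]].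
- have /cards1P[v sv] : #|s| == 1 by rewrite card_s cE0 cards0.
  exists s; first by rewrite sv inE set1_in_vertices.
  rewrite {1}cE cE0 /color_of; congr (_ :|: _); apply/esym/disjoint_setI0.
  by rewrite disjoints1 sv set1_notin_edges.
- have cEe : c :&: edges G = [set e].
    apply/esym/eqP; rewrite eqEcard sub1set eP cards1; exact: card_cE.
  have /setIP[ec eE] := eP.
  (* A vertex of [e] cannot also occur in [c] as a singleton, by disjointness, so [e] lies in [s];
     both have two elements. *)
  have es : e = s.
    apply/eqP; rewrite eqEcard card_s cEe cards1 (card_edge _ eE) leqnn andbT.
    apply/subsetP=> v ve; rewrite inE; apply/negP => vc.
    move/forall_inP: (disj_c _ ec) => /(_ _ vc)/implyP.
    have -> : e != [set v] by apply: contraTneq eE => ->; rewrite set1_notin_edges.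
    by move/(_ isT)/eqP/setP/(_ v); rewrite !inE ve eqxx.
  exists s; first by rewrite -es inE eE orbT.
  by rewrite {1}cE cEe /color_of -es (setIidPl _) // sub1set.
Qed.

End Simplices.

(** * Counting tuples of simplices with empty intersection *)

Section Counting.

Local Open Scope nat_scope.

Variables (G : sgraph) (r : nat).
Hypothesis r_gt0 : 0 < r.
Implicit Types (f : {ffun 'I_r -> {set G}}) (A : {set 'I_r}).

Definition simplices_on A (i : 'I_r) : {set {set G}} :=
  if i \in A then edges G else vertices G.

Definition families_on A : {set {ffun 'I_r -> {set G}}} :=
  [set f : {ffun 'I_r -> {set G}} | [forall i, f i \in simplices_on A i]].

Lemma card_forall_ffun (F : 'I_r -> {set {set G}}) :
  #|[set f : {ffun 'I_r -> {set G}} | [forall i, f i \in F i]]| = \prod_i #|F i|.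
Proof.
transitivity #|family F|; first by apply: eq_card => f; rewrite inE.
by rewrite card_family foldrE big_map big_enum.
Qed.

Lemma prod_if_mem A (a b : nat) :
  \prod_i (if i \in A then a else b) = a ^ #|A| * b ^ (r - #|A|).
Proof.
have -> : r - #|A| = #|~: A| by rewrite -[X in X - _](card_ord r) -(cardsC A) addKn.
rewrite (bigID (mem A)) /=; rewrite -!prod_nat_const; congr (_ * _); first by apply: eq_bigr => i ->.
by apply: eq_big => i; [rewrite inE | move/negbTE->].
Qed.

(** A set with at most one element contributes 1 in total to the left side. The only larger
    intersection is a common edge of all colors, which contributes 0 + 2. Emptiness can thus be
    counted through sizes of intersections. *)
Lemma card_bigcap_simplices A f : f \in families_on A ->
  (\bigcap_i f i == set0) + #|\bigcap_i f i|
    = 1 + ((A == setT) && [forall i, forall j, f i == f j]).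
Proof.
rewrite inE => /forallP fP; set B := \bigcap_i f i.
have B_sub i : B \subset f i by apply: bigcap_inf.
pose i0 := Ordinal r_gt0.
case: (eqVneq A setT) => [AT | /eqP A_neqT] /=; last first.
  (* Some color carries a vertex, so the intersection lies in a singleton. *)
  have [i iA] : exists i, i \notin A.
    apply/existsP; rewrite -negb_forall; apply/negP => /forallP AP.
    by apply: A_neqT; apply/setP=> i; rewrite AP inE.
  have := fP i; rewrite /simplices_on (negbTE iA) => /imsetP[v _ fi].
  have := subset_leq_card (B_sub i); rewrite fi cards1 -cards_eq0.
  by case: #|B| => [|[]].
have fE i : f i \in edges G by have := fP i; rewrite /simplices_on AT inE.
have card_f i : #|f i| = 2 by apply/card_edge.
case: (boolP [forall i, _]) => [/forallP f_const | f_nonconst].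
  have -> : B = f i0.
    apply/eqP; rewrite eqEsubset B_sub /=; apply/bigcapsP => i _.
    by have /forallP/(_ i)/eqP-> := f_const i0.
  by rewrite -cards_eq0 card_f.
(* If the intersection had two elements, it would equal each of the edges [f i]. *)
have B_lt2 : #|B| < 2.
  rewrite ltnNge; apply: contra f_nonconst => B_ge2.
  have Bf i : B = f i by apply/eqP; rewrite eqEcard B_sub card_f.
  by apply/forallP => i; apply/forallP => j; rewrite -!Bf.
by rewrite -cards_eq0; move: B_lt2; case: #|B| => [|[]].
Qed.

(** Double counting of the pairs of a family and a vertex [v] common to all its members. For fixed
    [v] the choices are independent: [deg v] edges for a color in [A], one vertex for any other. *)
Lemma sum_card_bigcap A :
  \sum_(f in families_on A) #|\bigcap_i f i| = \sum_(v : G) deg v ^ #|A|.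
Proof.
under eq_bigr do rewrite -sum1_card big_mkcond /=.
rewrite exchange_big; apply: eq_bigr => v _.
(* The factor [1 ^ (r - #|A|)] stands for the single vertex choice at each color outside [A]. *)
rewrite -[RHS]muln1 -[X in _ * X](exp1n (r - #|A|)) -prod_if_mem -big_mkcondr /=.
rewrite sum1dep_card.
pose F i := [set s in simplices_on A i | v \in s].
rewrite (eq_bigr (fun i => #|F i|)) => [|i _]; last first.
  rewrite /F /simplices_on; case: ifP => _.
    by rewrite card_edges_at.
  by rewrite card_vertices_at.
rewrite -card_forall_ffun; apply: eq_card => f; rewrite !inE.
apply/andP/forallP => [[/forallP fP /bigcapP vf] i | fP].
  by rewrite inE fP vf.
split; first by apply/forallP => i; have := fP i; rewrite inE => /andP[].
by apply/bigcapP => i _; have := fP i; rewrite inE => /andP[].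
Qed.

Lemma card_const_edges :
  #|[set f in families_on setT | [forall i, forall j, f i == f j]]| = #|edges G|.
Proof.
rewrite -(card_imset _ (f := fun e : {set G} => [ffun _ : 'I_r => e])); last first.
  by move=> e e' /ffunP/(_ (Ordinal r_gt0)); rewrite !ffunE.
apply: eq_card => f; rewrite !inE; apply/andP/imsetP => [[/forallP fP /forallP cf]|].
  exists (f (Ordinal r_gt0)).
    by have := fP (Ordinal r_gt0); rewrite /simplices_on inE.
  by apply/ffunP=> i; rewrite ffunE; apply/eqP; have /forallP := cf i; apply.
case=> e eE ->; split; apply/forallP => i; rewrite ?ffunE /simplices_on ?inE //.
by apply/forallP => j; rewrite !ffunE.
Qed.

Definition disjoint_families_on A : {set {ffun 'I_r -> {set G}}} :=
  [set f in families_on A | \bigcap_i f i == set0].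

(** Sum [card_bigcap_simplices] over the families. The additive form avoids truncated
    subtraction. *)
Lemma card_disjoint_families_on A :
  #|disjoint_families_on A| + \sum_(v : G) deg v ^ #|A|
    = #|edges G| ^ #|A| * #|G| ^ (r - #|A|) + (A == setT) * #|edges G|.
Proof.
rewrite -sum_card_bigcap -sum1dep_card big_mkcondr /= -big_split /=.
rewrite (eq_bigr _ (@card_bigcap_simplices A)) big_split /=.
congr (_ + _).
  rewrite sum1_card card_forall_ffun -prod_if_mem; apply: eq_bigr => i _.
  by rewrite /simplices_on; case: ifP => // _; rewrite card_vertices.
case: eqVneq => [->|_] /=; last by rewrite big1.
by rewrite mul1n -big_mkcondr sum1dep_card card_const_edges.
Qed.

(** * Cells as tuples of simplices *)

Definition edge_colors f : {set 'I_r} := [set i | f i \in edges G].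

(** No simplex is both a vertex and an edge, so a tuple of simplices belongs to exactly one
    [families_on A]. *)
Lemma families_onE A f :
  (f \in families_on A)
    = [forall i, f i \in vertices G :|: edges G] && (edge_colors f == A).
Proof.
have vertex_edge s : s \in vertices G -> (s \in edges G) = false.
  by case/imsetP=> v _ ->; apply: set1_notin_edges.
rewrite inE; apply/forallP/andP => [fP | [/forallP fP /eqP<-] i].
  split; first by apply/forallP => i; have := fP i;
    rewrite /simplices_on inE; case: ifP => _ ->; rewrite ?orbT.
  apply/eqP/setP=> i; have := fP i; rewrite /simplices_on inE.
  by case: ifP => // _ /vertex_edge.
by have := fP i; rewrite /simplices_on !inE; case: ifP; rewrite ?orbF.
Qed.

(** Each color of a cell comes from a simplex. A vertex is left uncovered exactly when it lies in
    all these simplices, and a color contains an edge exactly when its simplex is one. *)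
Lemma kcellsE k : 0 < #|G| ->
  kcells G [tuple of nseq r #|G|.-1] k =
  [set [tuple color_of G (f i) | i < r]
     | f : {ffun 'I_r -> {set G}} in
       [pred f : {ffun 'I_r -> {set G}} |
         [&& [forall i, f i \in vertices G :|: edges G],
             \bigcap_i f i == set0 & #|edge_colors f| == k]]].
Proof.
move=> n_gt0; apply/setP=> c.
have colorP i : tnth [tuple of nseq r #|G|.-1] i = #|G|.-1 by rewrite tnth_nseq.
have dimE f : Defs.dim [tuple color_of G (f i) | i < r] = #|edge_colors f|.
  rewrite -sum1dep_card big_mkcond; apply: eq_bigr => i _.
  by rewrite tnth_mktuple color_of_edges card_set1_edges; case: (_ \in _).
have coverE f : [forall v : G, exists i, [set v] \in tnth [tuple color_of G (f i) | i < r] i]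
    = (\bigcap_i f i == set0).
  apply/forallP/eqP => [covP | cap0 v].
    apply/setP=> v; rewrite inE; apply/negP => /bigcapP vf.
    have /existsP[i] := covP v.
    by rewrite tnth_mktuple set1_color_of vf.
  have : v \notin \bigcap_i f i by rewrite cap0 inE.
  apply: contraNT; rewrite negb_exists => /forallP vf.
  apply/bigcapP => i _; apply: negbNE.
  by have := vf i; rewrite tnth_mktuple set1_color_of.
rewrite inE; apply/andP/imsetP => [[/and3P[/forallP cC covc /forallP cD] dimc]|].
  have colc i : is_color G #|G|.-1 (tnth c i).
    by have /andP[sub_c card_c] := cC i; rewrite /is_color sub_c -(colorP i) card_c cD.
  (* The only possible preimage, as a simplex consists of the vertices missing as singletons from
     its color. *)
  pose f := [ffun i => [set v | [set v] \notin tnth c i]].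
  have fP i : f i \in vertices G :|: edges G /\ tnth c i = color_of G (f i).
    have [s s_simp cs] := is_color_color_of _ _ n_gt0 (colc i).
    have -> : f i = s.
      by apply/setP=> v; rewrite ffunE inE cs set1_color_of negbK.
    by split.
  have cE : c = [tuple color_of G (f i) | i < r].
    by apply: eq_from_tnth => i; rewrite tnth_mktuple; case: (fP i).
  exists f => //; rewrite inE -dimE -coverE -cE covc dimc !andbT.
  by apply/forallP => i; case: (fP i).
case=> f; rewrite inE => /and3P[/forallP fP cap0 card_f] ->.
have colf i := color_of_is_color _ _ (fP i).
rewrite dimE card_f /is_cell coverE cap0; split=> //.
apply/and3P; split=> //; apply/forallP => i; rewrite tnth_mktuple ?colorP.
  by have /and3P[-> ->] := colf i.
by have /and3P[] := colf i.
Qed.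

Lemma card_kcells k : 0 < #|G| ->
  #|kcells G [tuple of nseq r #|G|.-1] k|
    = \sum_(A : {set 'I_r} | #|A| == k) #|disjoint_families_on A|.
Proof.
move=> n_gt0; rewrite kcellsE // card_imset => [|f f' /eqP eq_ff']; last first.
  apply/ffunP=> i; apply: (@color_of_inj G).
  by move/eqP/(congr1 (fun c => tnth c i)): eq_ff'; rewrite !tnth_mktuple.
rewrite -sum1_card (partition_big edge_colors (fun A => #|A| == k)) /=; last first.
  by move=> f; rewrite inE => /and3P[].
apply: eq_bigr => A /eqP card_A; rewrite sum1dep_card.
apply: eq_card => f; rewrite [RHS]inE families_onE inE [in LHS]inE.
case: (eqVneq (edge_colors f) A) => [->|_]; last by rewrite !andbF.
by rewrite card_A eqxx !andbT.
Qed.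

Lemma card_kcells_sum k : 0 < #|G| ->
  #|kcells G [tuple of nseq r #|G|.-1] k| + 'C(r, k) * \sum_(v : G) deg v ^ k
    = 'C(r, k) * (#|edges G| ^ k * #|G| ^ (r - k)) + (k == r) * #|edges G|.
Proof.
move=> n_gt0.
have card_subsets (a : nat) : \sum_(A : {set 'I_r} | #|A| == k) a = 'C(r, k) * a.
  by rewrite sum_nat_const -[r in 'C(r, _)]card_ord -card_draws cardsE.
(* Only the full set of colors yields the extra term, and it has size [k] exactly when [k] is
   [r]. *)
have -> : (k == r) * #|edges G|
    = \sum_(A : {set 'I_r} | #|A| == k) (A == setT) * #|edges G|.
  rewrite (eq_bigr (fun=> (k == r) * #|edges G|)) => [|A /eqP<-]; last first.
    have := max_card A; rewrite card_ord => A_le_r.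
    by rewrite eqEcard subsetT cardsT card_ord eqn_leq A_le_r.
  by rewrite card_subsets; case: eqVneq => [->|_]; rewrite ?binn ?muln0 ?mul1n.
rewrite card_kcells // -!card_subsets -!big_split /=.
by apply: eq_bigr => A /eqP<-; apply: card_disjoint_families_on.
Qed.

End Counting.

Theorem theorem4p4 (G : sgraph) (n m r : nat)
    (hn : #|G| = n) (hm : #|edges G| = m) (hr : (2 <= r)%N)
    (hl : color_vector [tuple of nseq r n.-1]) (i : nat) :
  #|kcells G [tuple of nseq r n.-1] i|%:Z =
    if (i < r)%N then
      'C(r, i)%:Z * (m%:Z ^+ i * n%:Z ^+ (r - i) - \sum_(v : G) (deg v)%:Z ^+ i)
    else if i == r then
      m%:Z ^+ r + m%:Z - \sum_(v : G) (deg v)%:Z ^+ r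
    else 0.
Proof.
have r_gt0 : (0 < r)%N by apply: ltnW.
(* The entries n - 1 of the color vector are positive, which excludes n = 0. *)
have n_gt0 : (0 < #|G|)%N.
  by have := hl (Ordinal r_gt0); rewrite tnth_nseq hn; case: (n).
have PoszX (a k : nat) : (a ^ k)%N%:Z = a%:Z ^+ k by apply: rmorphXn.
(* Over the integers, the degree sum can be moved to the other side as a genuine subtraction. *)
have := congr1 Posz (card_kcells_sum _ _ r_gt0 i n_gt0).
rewrite hn hm !PoszD !PoszM !PoszX => /(canRL (addrK _)) ->.
have -> : Posz (\sum_(v : G) deg v ^ i)%N = \sum_(v : G) (deg v)%:Z ^+ i.
  rewrite (big_morph Posz PoszD (erefl 0)).
  by apply: eq_bigr => v _; rewrite PoszX.
case: ltngtP => [i_lt_r|r_lt_i|->].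
- by rewrite mul0r addr0 mulrBr.
(* For [i] above [r] the binomial coefficient is 0 and removes both remaining terms. *)
- by rewrite bin_small // !mul0r addr0 subr0.
- by rewrite binn subnn expr0 mulr1 !mul1r.
Qed.
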